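(* Suppose $l:\Omega_T\times[0,T]\times\mathbb{R}\to\mathbb{R}$ satisfies ($H_l$) and ($H'_l$), with $F$ the function in ($H'_l$), and $S$ satisfies ($H_S$). Let $(X,A)$ be the solution of the Skorokhod problem with mean reflection $\mathbb{SP}(l,S)$. Then there is a constant $C>0$ such that for any $0\le s\le t\le T$, $$|A_t-A_s|\le C\Big\{\sup_{r\in[s,t]}\widehat{\mathbb{E}}|S_r-S_s|+F(|t-s|)\Big\}$$ and $$\widehat{\mathbb{E}}\Big[\sup_{r\in[s,t]}|X_r-X_s|\Big]\le C\Big\{\widehat{\mathbb{E}}\Big[\sup_{r\in[s,t]}|S_r-S_s|\Big]+F(|t-s|)\Big\}.$$
   Context: **$G$-expectation framework.** Fix $T>0$ and $0<\underline{\sigma}^2<\overline{\sigma}^2$; $\Omega_T$ is the space of real-valued continuous functions on $[0,T]$ starting from $0$, with the supremum norm and Borel $\sigma$-algebra $\mathcal{B}(\Omega_T)$; $B$ is the canonical process; $G(a)=\frac12(\overline{\sigma}^2a^+-\underline{\sigma}^2a^-)$. $L_{ip}(\Omega_T)$ is the set of $\varphi(B_{t_1},\dots,B_{t_n})$ with $n\in\mathbb{N}$, $t_i\in[0,T]$, $\varphi$ bounded Lipschitz on $\mathbb{R}^n$. The $G$-expectation of $\xi=\varphi(B_{t_1},\dots,B_{t_n})$, $0=t_0\le t_1<\dots<t_n$, is $\widehat{\mathbb{E}}[\xi]=u_1(0,0)$, where, backwards in $k$, $u_k(t,x;x_1,\dots,x_{k-1})$ is the (viscosity) solution of $\partial_tu_k+G(\partial_x^2u_k)=0$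 on $[t_{k-1},t_k)\times\mathbb{R}$ with terminal condition $u_n(t_n,x;x_1,\dots,x_{n-1})=\varphi(x_1,\dots,x_{n-1},x)$ and $u_k(t_k,x;x_1,\dots,x_{k-1})=u_{k+1}(t_k,x;x_1,\dots,x_{k-1},x)$ for $k<n$. $L_G^p(\Omega_T)$ ($p\ge1$) is the completion of $L_{ip}(\Omega_T)$ under $\|\xi\|_{L_G^p}=(\widehat{\mathbb{E}}|\xi|^p)^{1/p}$. There is a weakly compact set $\mathcal{P}$ of probability measures on $(\Omega_T,\mathcal{B}(\Omega_T))$ with $\widehat{\mathbb{E}}[\xi]=\sup_{\mathsf{P}\in\mathcal{P}}\mathsf{E}^{\mathsf{P}}[\xi]$ for $\xi\in L_G^1(\Omega_T)$; the same formula defines $\widehat{\mathbb{E}}$ for other measurable random variables. A property holds quasi-surely (q.s.) if it holds outside a set $N$ with $\sup_{\mathsf{P}\in\mathcal{P}}\mathsf{P}(N)=0$; random variables that are equal q.s. are identified, and inequalities between random variables are understood q.s. **Process spaces.** $S_G^0(0,T)$ is the set of processes $f(t,B_{t_1\wedge t},\dots,B_{t_n\wedge t})$ with $t_i\in[0,T]$, $f$ bounded Lipschitz on $\mathbb{R}^{n+1}$; $S_G^p(0,T)$ is its completion under $\|\eta\|_{S_G^p}=(\widehat{\mathbb{E}}\sup_{t\in[0,T]}|\eta_t|^p)^{1/p}$. $I[0,T]$ is the set of deterministic continuous nondecreasing functions on $[0,T]$ with initial value $0$. **Assumptions** (dependence on $\omega$ is suppressed). ($H_l$) $l:\Omega_T\times[0,T]\times\mathbb{R}\to\mathbb{R}$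 satisfies: (1) $l(t,x)$ is uniformly continuous in $(t,x)$, uniformly in $\omega$; (2) for every $t$, $x\mapsto l(t,x)$ is strictly increasing, q.s.; (3) for every $(t,x)$, $l(t,x)\in L_G^1(\Omega_T)$, and $\widehat{\mathbb{E}}[\lim_{x\uparrow\infty}l(t,x)]>0$; (4) for some $\kappa>0$, $|l(t,x)|\le\kappa(1+|x|)$ q.s. for every $(t,x)$. ($H'_l$) There are an increasing continuous function $F:[0,\infty)\to[0,\infty)$ with $F(0)=0$ and constants $0<c_l<C_l$ such that (1) $|l(t,x)-l(s,x)|\le F(|t-s|)$ for all $t,s\in[0,T]$, $x\in\mathbb{R}$; (2) $c_l|x-y|\le|l(t,x)-l(t,y)|\le C_l|x-y|$ for all $t\in[0,T]$, $x,y\in\mathbb{R}$. ($H_S$) There exists $p\ge1$ such that $S\in S_G^p(0,T)$, and $\widehat{\mathbb{E}}[l(0,S_0)]\ge0$. **Skorokhod problem with mean reflection.** A solution of $\mathbb{SP}(l,S)$ is a pair $(X,A)\in S_G^p(0,T)\times I[0,T]$ such that for $t\in[0,T]$: (a) $X_t=S_t+A_t$; (b) $\widehat{\mathbb{E}}[l(t,X_t)]\ge0$; (c) $\int_0^T\widehat{\mathbb{E}}[l(t,X_t)]\,dA_t=0$. Under ($H_l$) and ($H_S$) it has exactly one solution. *)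

(* Defs.v *)
From HB Require Import structures.
From mathcomp Require Import all_boot all_order all_algebra.
From mathcomp Require Import all_classical all_reals all_analysis.

Set Implicit Arguments.
Unset Strict Implicit.
Unset Printing Implicit Defensive.

Import Order.TTheory GRing.Theory Num.Theory.
Import numFieldNormedType.Exports.

Local Open Scope classical_set_scope.
Local Open Scope ring_scope.

(* A continuous function on [0, T] starting from 0 is represented by its
   extension by 0 outside [0, T]; the last field makes the representation
   unique, so that two elements are equal iff they agree on [0, T]. *)
Record Omega (R : realType) (T : R) := MkOmega {
  path_val :> R -> R ;
  path_cont : {within `[0, T], continuous path_val} ;
  path_0 : path_val 0 = 0 ;
  path_out : forall t, t \notin `[0, T] -> path_val t = 0 }.

Section path_space.
Context {R : realType} (T : R).
Implicit Types v w z : Omega T.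

Lemma Omega_eq v w : path_val v = path_val w -> v = w.
Proof.
case: v => v ? ? ?; case: w => w ? ? ? /= vw; subst w.
by congr MkOmega; exact: Prop_irrelevance.
Qed.

HB.instance Definition _ := gen_eqMixin (Omega T).
HB.instance Definition _ := gen_choiceMixin (Omega T).

Let zero_cont : {within `[0, T], continuous (fun _ : R => 0 : R)}.
Proof. by apply: continuous_subspaceT => x; exact: cvg_cst. Qed.

HB.instance Definition _ := isPointed.Build (Omega T)
  (MkOmega zero_cont (erefl (0 : R)) (fun _ _ => erefl)).

Definition sup_dist v w : R := sup [set `|v t - w t| | t in `[0, T]].

Let dist_le v w t : t \in `[0, T] -> `|v t - w t| <= sup_dist v w.
Proof.
move=> tT; apply: ub_le_sup; last by exists t.
have vwc : {within `[0, T], continuous (fun t => `|v t - w t|)}.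
  move=> x; apply: cvg_norm; apply: cvgB; [exact: path_cont|exact: path_cont].
have [|c _ cmax] := @EVT_max R (fun t => `|v t - w t|) 0 T _ vwc.
  by move: tT; rewrite in_itv/= => /andP[]; exact: le_trans.
by exists `|v c - w c| => _ [s sT <-]; exact: cmax.
Qed.

Let dist_le_ub v w c : 0 <= c ->
  (forall t, t \in `[0, T] -> `|v t - w t| <= c) -> sup_dist v w <= c.
Proof.
move=> c0 vwc; rewrite /sup_dist.
have [->|/set0P ne] := eqVneq [set `|v t - w t| | t in `[0, T]] set0.
  by rewrite sup0.
by apply: ge_sup => // _ [t tT <-]; exact: vwc.
Qed.

Let dist_ge0 v w : 0 <= sup_dist v w.
Proof.
have [T0|T0] := leP 0 T.
  by rewrite (le_trans _ (@dist_le v w 0 _))// in_itv/= lexx.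
rewrite /sup_dist [X in sup X](_ : _ = set0) ?sup0//.
rewrite -subset0 => x [t]; rewrite /= in_itv/= => /andP[t0 tT] _.
by move: (le_lt_trans (le_trans t0 tT) T0); rewrite ltxx.
Qed.

Let distxx v : sup_dist v v = 0.
Proof.
apply/eqP; rewrite eq_le dist_ge0 andbT; apply: dist_le_ub => // t _.
by rewrite subrr normr0.
Qed.

Let dist_pos v w : sup_dist v w = 0 -> v = w.
Proof.
move=> vw0; apply: Omega_eq; apply/funext => t.
have [tT|tT] := boolP (t \in `[0, T]); last by rewrite !path_out.
by apply/eqP; rewrite -subr_eq0 -normr_le0 -vw0; exact: dist_le.
Qed.

Let distC v w : sup_dist v w = sup_dist w v.
Proof.
by rewrite /sup_dist; congr sup; apply: eq_imagel => t _; rewrite distrC.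
Qed.

Let dist_tri w v z : sup_dist v z <= sup_dist v w + sup_dist w z.
Proof.
apply: dist_le_ub => [|t tT]; first exact: addr_ge0.
by rewrite (le_trans (ler_distD (w t) _ _))// lerD// dist_le.
Qed.

HB.instance Definition _ := @isMetric.Build R (Omega T)
  sup_dist distxx dist_pos distC dist_tri.

End path_space.

Definition BOmega (R : realType) (T : R) :=
  g_sigma_algebraType (@open (Omega T)).

HB.instance Definition _ (R : realType) (T : R) := Measurable.on (BOmega T).

Section G_expectation.
Context {R : realType}.

Section G_heat.
Variables (slo shi : R).

Definition G (a : R) : R :=
  2^-1 * (shi ^+ 2 * Num.max a 0 - slo ^+ 2 * Num.max (- a) 0).

Definition d_t (psi : R -> R -> R) (t x : R) : R := derive1 (psi ^~ x) t.
Definition d_x (psi : R -> R -> R) (t x : R) : R := derive1 (psi t) x.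
Definition d_xx (psi : R -> R -> R) : R -> R -> R := d_x (d_x psi).

Definition C12 (psi : R -> R -> R) : Prop :=
  [/\ forall t x, derivable (psi ^~ x) t 1,
      forall t x, derivable (psi t) x 1,
      forall t x, derivable (d_x psi t) x 1 &
   [/\ continuous (fun z : R * R => d_t psi z.1 z.2),
       continuous (fun z : R * R => d_x psi z.1 z.2) &
       continuous (fun z : R * R => d_xx psi z.1 z.2)]].

(* The equation is posed backwards in time, with a terminal condition, hence
   the direction of the inequalities. *)
Definition G_subsolution (a b : R) (u : R -> R -> R) : Prop :=
  forall psi, C12 psi -> forall t x, t \in `[a, b[ ->
    (forall s y, s \in `[a, b[ -> u s y <= psi s y) -> u t x = psi t x ->
    0 <= d_t psi t x + G (d_xx psi t x).

Definition G_supersolution (a b : R) (u : R -> R -> R) : Prop :=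
  forall psi, C12 psi -> forall t x, t \in `[a, b[ ->
    (forall s y, s \in `[a, b[ -> psi s y <= u s y) -> u t x = psi t x ->
    d_t psi t x + G (d_xx psi t x) <= 0.

(* Boundedness is the class in which the viscosity solution with a given
   bounded terminal value is unique. *)
Definition G_viscosity_solution (a b : R) (u : R -> R -> R) : Prop :=
  [/\ {within `[a, b] `*` setT, continuous (fun z : R * R => u z.1 z.2)},
      exists M : R, forall t x, t \in `[a, b] -> `|u t x| <= M,
      G_subsolution a b u & G_supersolution a b u].

(* [c] is the G-expectation of phi (B_{t_1}, ..., B_{t_{n+1}}), where ts is
   the increasing list of times. [u k xs t x], with xs = [:: x_1; ...; x_k],
   is the function u_{k+1}(t, x; x_1, ..., x_k), which lives on
   [t_k, t_{k+1}] with t_0 = 0. *)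
Definition G_value (n : nat) (phi : 'rV[R]_n.+1 -> R) (ts : n.+1.-tuple R)
    (c : R) : Prop :=
  exists u : forall k, k.-tuple R -> R -> R -> R,
  [/\ forall k (xs : k.-tuple R), (k <= n)%N ->
        G_viscosity_solution (nth 0 (0 :: ts) k) (nth 0 ts k) (u k xs),
      forall k (xs : k.-tuple R) x, (k < n)%N ->
        u k xs (nth 0 ts k) x = u k.+1 [tuple of rcons xs x] (nth 0 ts k) x,
      forall (xs : n.-tuple R) x,
        u n xs (nth 0 ts n) x = phi (\row_i tnth [tuple of rcons xs x] i) &
      c = u 0%N [tuple] 0 0].

End G_heat.

Section expectation.
Variable (T : R).

Definition bounded_lipschitz (n : nat) (phi : 'rV[R]_n.+1 -> R) : Prop :=
  bounded_fun phi /\ [lipschitz phi x | x in setT].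

Definition bounded_continuous :=
  {f : Omega T -> R | bounded_fun f /\ continuous f}.

Definition integrals (mu : probability (BOmega T) R) :
    {ptws bounded_continuous -> R} :=
  fun f => fine (\int[mu]_w (sval f w)%:E).

(* The topology of weak convergence of probability measures is the coarsest
   one for which the integrals of bounded continuous functions are
   continuous. *)
Definition weakly_compact (P : set (probability (BOmega T) R)) : Prop :=
  compact (P : set (initial_topology integrals)).

Variable (P : set (probability (BOmega T) R)).

Definition Ehat (xi : Omega T -> \bar R) : \bar R :=
  ereal_sup [set (\int[mu]_w xi w)%E | mu in P].

Definition quasi_surely (A : Omega T -> Prop) : Prop :=
  exists N : set (BOmega T), [/\ measurable N,
    ereal_sup [set mu N | mu in P] = 0%E & forall w, ~ N w -> A w].

(* By density, the formula on random variables phi (B_{t_1}, ..., B_{t_n})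
   determines the G-expectation on the whole of L_G^1. *)
Definition represents_G_expectation (slo shi : R) : Prop :=
  weakly_compact P /\
  forall (n : nat) (phi : 'rV[R]_n.+1 -> R) (ts : n.+1.-tuple R),
    bounded_lipschitz phi -> sorted <%R ts ->
    (forall i, tnth ts i \in `[0, T]) ->
    exists2 c : R, G_value slo shi phi ts c &
      Ehat (fun w => (phi (\row_i w (tnth ts i)))%:E) = c%:E.

Definition Lip : set (Omega T -> R) :=
  [set xi | exists (n : nat) (phi : 'rV[R]_n.+1 -> R) (ts : 'I_n.+1 -> R),
    [/\ bounded_lipschitz phi, forall i, ts i \in `[0, T] &
        xi = fun w : Omega T => phi (\row_i w (ts i))]].

Definition LG_norm (p : R) (xi : Omega T -> R) : \bar R :=
  (Ehat (fun w => (`|xi w| `^ p)%:E) `^ p^-1)%E.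

(* The completion of [Lip], realized as its closure among Borel measurable
   random variables. *)
Definition LG (p : R) : set (Omega T -> R) :=
  [set xi : Omega T -> R | measurable_fun [set: BOmega T] (xi : BOmega T -> R) /\
    exists xi_ : nat -> Omega T -> R, (forall k, Lip (xi_ k)) /\
      LG_norm p (fun w => xi w - xi_ k w) @[k --> \oo] --> 0%E].

Definition SG0 : set (Omega T -> R -> R) :=
  [set eta | exists (n : nat) (f : 'rV[R]_(1 + n.+1) -> R)
      (ts : 'I_n.+1 -> R),
    [/\ bounded_lipschitz f, forall i, ts i \in `[0, T] &
        eta = fun (w : Omega T) t => f (row_mx t%:M (\row_i w (Num.min (ts i) t)))]].

Definition SG_norm (p : R) (eta : Omega T -> R -> R) : \bar R :=
  (Ehat (fun w => ereal_sup [set (`|eta w t| `^ p)%:E | t in `[0%R, T]])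
    `^ p^-1)%E.

(* The completion of [SG0], realized as its closure among the processes with
   quasi-surely continuous paths; a limit of [SG0] for [SG_norm] is a
   quasi-sure uniform limit of a subsequence, and continuity makes the supremum
   over [0, T] measurable up to a polar set. *)
Definition SG (p : R) : set (Omega T -> R -> R) :=
  [set eta : Omega T -> R -> R |
    [/\ forall t, t \in `[0, T] ->
          measurable_fun [set: BOmega T] (eta ^~ t : BOmega T -> R),
        quasi_surely (fun w => {within `[0, T], continuous (eta w)}) &
        exists eta_ : nat -> Omega T -> R -> R, (forall k, SG0 (eta_ k)) /\
          SG_norm p (fun w t => eta w t - eta_ k w t) @[k --> \oo] --> 0%E]].

End expectation.

End G_expectation.

(* Values outside [0, T] are irrelevant. *)
Record incr_fun (R : realType) (T : R) := MkIncrFun {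
  incr_val :> R -> R ;
  incr_cont : {within `[0, T], continuous incr_val} ;
  incr_nd : {in `[0, T] &, {homo incr_val : s t / s <= t}} ;
  incr_0 : incr_val 0 = 0 }.

Section stieltjes.
Context {R : realType} (T : R).

(* A Stieltjes measure is built from a function on the whole line, whence the
   extension of A by constants outside [0, T], which adds no mass. *)
Definition freeze (A : incr_fun T) (t : R) : R := A (Num.max 0 (Num.min t T)).

Let clamp_in t : 0 <= T -> Num.max 0 (Num.min t T) \in `[0, T].
Proof.
by move=> T0; rewrite in_itv/= le_max lexx/= ge_max T0/= ge_min lexx orbT.
Qed.

Let clamp_lt0 t : T < 0 -> Num.max 0 (Num.min t T) = 0.
Proof. by move=> T0; apply/max_l; rewrite ge_min (ltW T0) orbT. Qed.

Let freeze_nd A : nondecreasing (freeze A).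
Proof.
move=> s t st; rewrite /freeze; have [T0|T0] := leP 0 T; last first.
  by rewrite !clamp_lt0.
apply: incr_nd; [exact: clamp_in|exact: clamp_in|].
by rewrite ge_max !le_max lexx/= le_min !ge_min st lexx !orbT.
Qed.

Let freeze_cont A : continuous (freeze A).
Proof.
move=> t; have [T0|T0] := leP 0 T; last first.
  rewrite (_ : freeze A = cst (A 0)); first exact: cst_continuous.
  by apply/funext => s; rewrite /freeze clamp_lt0.
pose c (s : R) := Num.max 0 (Num.min s T).
have cc : c s @[s --> t] --> c t.
  apply: (@continuous_max _ _ (fun=> 0) (fun s => Num.min s T)).
    exact: cst_continuous.
  by apply: (@continuous_min _ _ id (fun=> T));
    [exact: cvg_id | exact: cst_continuous].
have ct := clamp_in t T0.
move/subspace_continuousP : (@incr_cont _ _ A) => /(_ _ ct) Act.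
move=> V /Act; rewrite /within/= => /cc cV.
apply: (@filterS _ (nbhs t) _ _ _ _ cV) => s /=; apply; exact: clamp_in.
Qed.

Let freeze_rc A : right_continuous (freeze A).
Proof. by move=> t; exact: (cvg_at_right_filter (@freeze_cont A t)). Qed.

HB.instance Definition _ (A : incr_fun T) :=
  isCumulative.Build R _ R (freeze A) (freeze_nd A) (@freeze_rc A).

Definition stieltjes_integral (f : R -> \bar R) (A : incr_fun T) : \bar R :=
  (\int[lebesgue_stieltjes_measure (freeze A)]_(t in `[0%R, T]) f t)%E.

End stieltjes.

Section mean_reflection.
Context {R : realType} (T : R) (P : set (probability (BOmega T) R)).
Implicit Types (l : Omega T -> R -> R -> R) (S X : Omega T -> R -> R).

Definition Hl l : Prop :=
  [/\ forall e : R, 0 < e -> exists2 d : R, 0 < d &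
        forall w s t x y, s \in `[0, T] -> t \in `[0, T] ->
          `|t - s| < d -> `|x - y| < d -> `|l w t x - l w s y| < e,
      forall t, t \in `[0, T] -> quasi_surely P (fun w =>
        {homo l w t : x y / x < y}),
      (forall t x, t \in `[0, T] -> LG P 1 (fun w => l w t x)) /\
      (forall t, t \in `[0, T] ->
        (0 < Ehat P (fun w => lim ((l w t x)%:E @[x --> +oo%R])))%E) &
      exists2 kappa : R, 0 < kappa & forall t x, t \in `[0, T] ->
        quasi_surely P (fun w => `|l w t x| <= kappa * (1 + `|x|))].

Definition Hl' l (F : R -> R) (cl Cl : R) : Prop :=
  [/\ [/\ {within `[0, +oo[, continuous F},
          {in `[0, +oo[ &, {homo F : a b / a <= b}},
          forall a, 0 <= a -> 0 <= F a & F 0 = 0],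
      0 < cl < Cl,
      forall s t x, s \in `[0, T] -> t \in `[0, T] ->
        quasi_surely P (fun w => `|l w t x - l w s x| <= F `|t - s|) &
      forall t x y, t \in `[0, T] ->
        quasi_surely P (fun w => cl * `|x - y| <= `|l w t x - l w t y| /\
                                 `|l w t x - l w t y| <= Cl * `|x - y|)].

Definition HS (p : R) l S : Prop :=
  [/\ 1 <= p, SG P p S & (0 <= Ehat P (fun w => (l w 0%R (S w 0%R))%:E))%E].

Definition SP_solution (p : R) l S X (A : incr_fun T) : Prop :=
  [/\ SG P p X,
      forall t, t \in `[0, T] -> quasi_surely P (fun w => X w t = S w t + A t),
      forall t, t \in `[0, T] -> (0 <= Ehat P (fun w => (l w t (X w t))%:E))%E &
      stieltjes_integral (fun t => Ehat P (fun w => (l w t (X w t))%:E)) A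
        = 0%E].

End mean_reflection.

(* Main.v *)
Require Import Defs.
From HB Require Import structures.
From mathcomp Require Import all_boot all_order all_algebra.
From mathcomp Require Import all_classical all_reals all_analysis.
From mathcomp Require Import measurable_realfun ring lra.

(* If A_s < A_t then, since dA does not charge the set where E[l(r,X_r)] > 0,
   there is a time v in (s,t] with A_v as close to A_t as desired and
   E[l(v,X_v)] arbitrarily small. The bi-Lipschitz bounds and the modulus F give
     c_l (A_v - A_s) + l(s,X_s) <= l(v,X_v) + C_l |S_v - S_s| + F(|v-s|) q.s.
   It remains to integrate under a measure that nearly attains the supremum in
   E[l(s,X_s)] >= 0. The second estimate follows from
   |X_r - X_s| <= |S_r - S_s| + A_t - A_s. Suprema over [s,t] are only
   measurable up to a polar set; integrals of nonnegative functions being lower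
   integrals, almost-sure inequalities integrate without measurability. *)

Set Implicit Arguments.
Unset Strict Implicit.
Unset Printing Implicit Defensive.

Import Order.TTheory GRing.Theory Num.Theory.
Import numFieldNormedType.Exports.

Local Open Scope classical_set_scope.
Local Open Scope ring_scope.

(** * Comparison of integrals without measurability *)

Section lower_integral.
Context d (T : measurableType d) (R : realType).
Variable mu : {measure set T -> \bar R}.
Local Open Scope ereal_scope.
Import HBNNSimple.

(* The integral of a nonnegative function is a supremum over the simple
   functions below it, and simple functions can be cut off on a null set. *)
Lemma ae_ge0_le_lower_integral (f g : T -> \bar R) :
  (forall x, 0 <= f x) -> (forall x, 0 <= g x) ->
  {ae mu, forall x, f x <= g x} -> \int[mu]_x f x <= \int[mu]_x g x.
Proof.
move=> f0 g0 [N [mN muN fgN]]; rewrite !ge0_integralTE//.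
apply: ge_ereal_sup => _ [h hf <-].
pose k : {nnsfun T >-> R} := (h \* indic_nnsfun R (measurableC mN))%R.
apply: (@le_trans _ _ (sintegral mu k)).
  rewrite -!integralT_nnsfun; apply: ae_ge0_le_integral => //.
  - by move=> x _; rewrite lee_fin.
  - by apply/measurable_EFinP; exact: measurable_funP.
  - by move=> x _; rewrite lee_fin.
  - by apply/measurable_EFinP; exact: measurable_funP.
  exists N; split => // x /= hk; apply: contrapT => Nx; apply: hk => _.
  by rewrite lee_fin /k/= mindicE mem_set// mulr1.
apply: ereal_sup_ubound; exists k => //= x; rewrite mindicE.
have [Nx|Nx] := boolP (x \in ~` N); last by rewrite mulr0.
rewrite mulr1 (le_trans (hf x))//; apply: contrapT => fg.
by move: Nx; rewrite inE; apply; exact: fgN.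
Qed.

(** Positive parts are ordered as [f] and [g], negative parts in reverse; the nonnegative case
    applies to each. *)
Lemma ae_le_integral (f g : T -> \bar R) :
  {ae mu, forall x, f x <= g x} -> \int[mu]_x f x <= \int[mu]_x g x.
Proof.
move=> fg; rewrite [leLHS]integralE [leRHS]integralE; apply: leeB.
  apply: ae_ge0_le_lower_integral => //; apply: filterS fg => x fg.
  by rewrite !funeposE ge_max !le_max fg lexx orbT.
apply: ae_ge0_le_lower_integral => //; apply: filterS fg => x fg.
by rewrite !funenegE ge_max !le_max leeN2 fg lexx orbT.
Qed.

(** A Chebyshev bound that allows a non-measurable [f]: extension by 0 turns it into a comparison of
    lower integrals. *)
Lemma measurable_cst_le_lower_integral (f : T -> \bar R) (D E : set T) (e : R) :
  measurable E -> E `<=` D -> (0 <= e)%R -> (forall x, D x -> 0 <= f x) ->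
  (forall x, E x -> e%:E <= f x) -> e%:E * mu E <= \int[mu]_(x in D) f x.
Proof.
move=> mE ED e0 f0 ef; rewrite -integral_cst// [leLHS]integral_mkcond.
rewrite [leRHS]integral_mkcond; apply: ae_ge0_le_lower_integral.
- by move=> x; rewrite patchE; case: ifP; rewrite ?lee_fin.
- by move=> x; rewrite patchE; case: ifPn => //; rewrite inE; exact: f0.
apply: nearW => x; rewrite !patchE; case: ifPn => [|_].
  by rewrite inE => Ex; rewrite mem_set ?ef//; exact: ED.
by case: ifPn => //; rewrite inE; exact: f0.
Qed.

End lower_integral.

(** * Measurability of Carathéodory functions *)

Section caratheodory.
Context d (T : measurableType d) (R : realType).

(** Rounding [X] down to the grid of mesh 1/(n+1) makes the second argument constant on countably
    many measurable pieces; continuity in that argument gives the pointwise limit. *)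
Lemma measurable_caratheodory (f : T -> R -> R) (X : T -> R) :
  (forall x, measurable_fun setT (f ^~ x)) -> (forall w, continuous (f w)) ->
  measurable_fun setT X -> measurable_fun setT (fun w => f w (X w)).
Proof.
move=> mf cf mX.
pose r (n : nat) (x : R) : R := (Num.floor (n.+1%:R * x))%:~R / n.+1%:R.
have r_cvg x : r n x @[n --> \oo] --> x.
  apply/cvgrPdist_le => e e0; near=> n.
  have n0 : (0 : R) < n.+1%:R by [].
  have xE : x = n.+1%:R * x / n.+1%:R by rewrite mulrAC divff// mul1r.
  rewrite {1}xE /r -mulrBl normrM normfV (gtr0_norm n0) ler_pdivrMr//.
  have /andP[f1 f2] := floor_itv (n.+1%:R * x).
  rewrite ger0_norm ?subr_ge0// (@le_trans _ _ 1)//.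
    by rewrite lerBlDl ltW//; move: f2; rewrite intrD.
  rewrite -ler_pdivrMr// div1r ltW//.
  by near: n; exact: (near_infty_natSinv_lt (PosNum e0)).
apply: (@measurable_fun_cvg _ _ _ _ (fun n w => f w (r n (X w)))).
  move=> n _ Y mY; rewrite setTI.
  rewrite (_ : _ @^-1` _ = \bigcup_(z in [set: int])
    ([set w | Num.floor (n.+1%:R * X w) = z] `&`
     [set w | f w (z%:~R / n.+1%:R) \in Y])); last first.
    apply/seteqP; split=> [w /= Yw|w [z _ [/= <-]]]; last by rewrite inE.
    by exists (Num.floor (n.+1%:R * X w)) => //=; rewrite inE.
  apply: countable_bigcupT_measurable => [|z]; first exact: countableP.
  apply: measurableI; last first.
    rewrite (_ : [set _ | _] = (f ^~ (z%:~R / n.+1%:R)) @^-1` Y).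
      by rewrite -[X in measurable X]setTI; exact: mf.
    by apply/seteqP; split => w /=; rewrite inE.
  rewrite (_ : [set _ | _] =
    (fun w => n.+1%:R * X w) @^-1` `[z%:~R, (z + 1)%:~R[%classic).
    rewrite -[X in measurable X]setTI.
    apply: (_ : measurable_fun setT (fun w => n.+1%:R * X w)) => //.
    exact: measurable_funM.
  apply/seteqP; split => w /=; rewrite in_itv/=.
    by move=> <-; exact: floor_itv.
  by move=> h; apply: floor_def.
by move=> w _; exact: cvg_comp (r_cvg _) (cf _ _).
Unshelve. all: end_near. Qed.

End caratheodory.

(** * Extending inequalities from rational points by continuity *)

Lemma dense_rat_le (R : realType) (f g : R -> R) :
  continuous f -> continuous g ->
  (forall q : rat, f (ratr q) <= g (ratr q)) -> forall x, f x <= g x.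
Proof.
move=> cf cg fg x; rewrite leNgt; apply/negP => gfx.
have : \forall y \near x, 0 < f y - g y.
  have fgx : f y - g y @[y --> x] --> f x - g x.
    by apply: cvgB; [exact: cf|exact: cg].
  by apply: (cvgr_gt _ fgx); rewrite subr_gt0.
case/nbhs_ballP => e /= e0 xe.
have [q] : exists q : rat, ratr q \in `]x, (x + e)[.
  by apply: rat_in_itvoo; rewrite ltrDl.
rewrite in_itv/= => /andP[xq qe].
have /= := xe (ratr q); rewrite subr_gt0 ltNge fg => /(_ _)/negP; apply => //.
by rewrite /ball/= ltr_distlC; apply/andP; split; lra.
Qed.

Section clamp.
Context {R : realType}.

(** Retraction of the line onto [a, b]. Composing with it turns continuity within [a, b] into
    continuity on the line, and the images of the rationals are dense in [a, b], even if a = b. *)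
Definition clamp (a b x : R) : R := Num.max a (Num.min x b).

Lemma clamp_itv (a b x : R) : a <= b -> clamp a b x \in `[a, b].
Proof.
by move=> ab; rewrite in_itv/= le_max lexx ge_max ab/= ge_min lexx orbT.
Qed.

Lemma clampK (a b x : R) : x \in `[a, b] -> clamp a b x = x.
Proof.
by rewrite in_itv/= => /andP[ax xb]; rewrite /clamp (min_idPl xb) (max_idPr ax).
Qed.

Lemma continuous_clamp (a b : R) (f : R -> R) : a <= b ->
  {within `[a, b], continuous f} -> continuous (f \o clamp a b).
Proof.
move=> ab cf x.
have cc : clamp a b y @[y --> x] --> clamp a b x.
  apply: (@continuous_max _ _ (fun=> a) (fun s => Num.min s b)).
    exact: cst_continuous.
  by apply: (@continuous_min _ _ id (fun=> b));
    [exact: cvg_id | exact: cst_continuous].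
move/subspace_continuousP : cf => /(_ _ (clamp_itv x ab)) cf.
move=> V /cf; rewrite /within/= => /cc cV.
apply: (@filterS _ (nbhs x) _ _ _ _ cV) => s /=; apply; exact: clamp_itv.
Qed.

Lemma clamp_rat_le (a b : R) (f g : R -> R) : a <= b ->
  {within `[a, b], continuous f} -> {within `[a, b], continuous g} ->
  (forall q : rat, f (clamp a b (ratr q)) <= g (clamp a b (ratr q))) ->
  forall x, x \in `[a, b] -> f x <= g x.
Proof.
move=> ab cf cg fg x xab; rewrite -(clampK xab).
exact: (dense_rat_le (continuous_clamp ab cf) (continuous_clamp ab cg)).
Qed.

End clamp.

(** * Countable families of properties and of functions *)

Lemma ae_forall_countable d (T : measurableType d) (R : realType)
    (mu : {measure set T -> \bar R}) (I : countType) (Q : I -> T -> Prop) :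
  (forall i, \forall x \ae mu, Q i x) -> \forall x \ae mu, forall i, Q i x.
Proof.
move=> muQ.
have : \forall x \ae mu, forall n, oapp (Q^~ x) True (unpickle n).
  apply/ae_foralln => n.
  by case: (unpickle n) => [i|] /=; [exact: muQ|exact: nearW].
by apply: filterS => x Qx i; have := Qx (pickle i); rewrite pickleK.
Qed.

Lemma measurable_fun_ereal_sup_countable d (T : measurableType d) (R : realType)
    (I : countType) (f : I -> T -> \bar R) :
  (forall i, measurable_fun setT (f i)) ->
  measurable_fun setT (fun x => ereal_sup (range (f^~ x))).
Proof.
(* Numbers that code no index contribute [-oo], which is neutral for the supremum. *)
move=> mf; pose g n x := oapp (f^~ x) -oo%E (unpickle n).
rewrite (_ : (fun x => _) = (fun x => esups (g^~ x) 0%N)).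
  apply: measurable_fun_esups => n; rewrite /g.
  by case: (unpickle n) => [i|] /=; [exact: mf|exact: measurable_cst].
apply/funext => x; apply/eqP; rewrite eq_le; apply/andP; split.
  apply: ge_ereal_sup => _ [i _ <-]; apply: ereal_sup_ubound.
  by exists (pickle i); rewrite /= ?/g ?pickleK.
apply: ge_ereal_sup => _ [n _ <-]; rewrite /g.
case: (unpickle n) => [i|] /=; last exact: leNye.
by apply: ereal_sup_ubound; exists i.
Qed.

(** * Consequence of the flatness condition on dA *)

Lemma stieltjes_integral_eq0_lt (R : realType) (T : R) (A : incr_fun T)
    (f : R -> \bar R) (u t e : R) :
  (forall x, x \in `[0, T] -> (0 <= f x)%E) -> stieltjes_integral f A = 0%E ->
  0 <= u -> u < t -> t <= T -> A u < A t -> 0 < e ->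
  exists2 v, v \in `]u, t] & (f v < e%:E)%E.
Proof.
move=> f0 If0 u0 ut tT Aut e0; apply/not_exists2P => ef.
have T0 : 0 <= T by exact: le_trans (le_trans u0 (ltW ut)) tT.
(* If [f] were at least [e] on ]u, t], its integral would be at least e (A_t - A_u) > 0. *)
have : (e%:E * lebesgue_stieltjes_measure (freeze A) `]u, t]%classic <= 0)%E.
  rewrite -[leRHS]If0; apply: measurable_cst_le_lower_integral.
  - exact: measurable_itv.
  - move=> x /=; rewrite !in_itv/= => /andP[ux xt].
    by rewrite (le_trans u0 (ltW ux)) (le_trans xt).
  - exact: ltW.
  - exact: f0.
  - by move=> x /= xut; case: (ef x) => // /negP; rewrite -leNgt.
(* The extended measure agrees with the length on half-open intervals, and [freeze] changes nothing
   at [u] and [t]. *)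
have -> : lebesgue_stieltjes_measure (freeze A) `]u, t]%classic
    = (A t - A u)%:E.
  rewrite /lebesgue_stieltjes_measure /measure_extension/=.
  rewrite measurable_mu_extE/=; last exact: is_ocitv.
  rewrite wlength_itv/= lte_fin ut -EFinB /freeze.
  rewrite -!/(clamp 0 T _) !clampK// in_itv/=; apply/andP; split => //; lra.
by rewrite -EFinM lee_fin leNgt mulr_gt0// subr_gt0.
Qed.

#[local] Instance ae_filter_BOmega (R : realType) (T : R)
  (mu : probability (BOmega T) R) : Filter (almost_everywhere mu).
Proof. exact: ae_filter_ringOfSetsType. Qed.

(** * Quasi-sure properties and integrability under each measure of P *)

Section G_framework.
Context {R : realType} (T : R) (P : set (probability (BOmega T) R)).
Implicit Types (l : Omega T -> R -> R -> R) (S X : Omega T -> R -> R).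
Implicit Type mu : probability (BOmega T) R.

Lemma quasi_surely_ae mu (Q : Omega T -> Prop) :
  P mu -> quasi_surely P Q -> \forall w \ae mu, Q w.
Proof.
move=> Pmu [N [mN PN NQ]]; exists N; split => //.
  apply/eqP; rewrite eq_le measure_ge0 andbT -PN.
  by apply: ereal_sup_ubound; exists mu.
by move=> w /= Qw; apply: contrapT => /NQ.
Qed.

Lemma le_Ehat (f g : Omega T -> \bar R) :
  (forall mu, P mu -> {ae mu, forall w, (f w <= g w)%E}) ->
  (Ehat P f <= Ehat P g)%E.
Proof.
move=> fg; apply: ge_ereal_sup => _ [mu Pmu <-].
apply: (le_trans (ae_le_integral (fg _ Pmu))).
by apply: ereal_sup_ubound; exists mu.
Qed.

Lemma integral_le_Ehat mu (f : Omega T -> \bar R) :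
  P mu -> (\int[mu]_w f w <= Ehat P f)%E.
Proof. by move=> Pmu; apply: ereal_sup_ubound; exists mu. Qed.

(** Some [eta k] in [SG0] lies at distance less than 1 from [X] and is bounded by some M at time
    [v]. Since x <= 1 + x^p, this gives |X_v| <= M + 1 + |X_v - eta_v|^p, and the last term has
    finite expectation. *)
Lemma SG_integrable (p : R) X mu (v : R) : 1 <= p -> SG P p X -> P mu ->
  v \in `[0, T] -> mu.-integrable setT (fun w => (X w v)%:E).
Proof.
move=> p1 [mX _ [eta [eta0 Xeta]]] Pmu vT.
have [k] : exists k, (SG_norm P p (fun w t => (X w t - eta k w t)%R) < 1)%E.
  have nbhs1 : nbhs (0%E : \bar R) [set y | (y < 1)%E].
    apply: open_nbhs_nbhs; split; first exact: open_ereal_lt_ereal.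
    by rewrite /= lte_fin.
  by have [k _ /(_ k (leqnn k)) Xk] := Xeta _ nbhs1; exists k.
rewrite /SG_norm; set E := Ehat _ _ => E1.
have Efin : (E < +oo)%E.
  rewrite ltey; apply/eqP => Ey; move: E1; rewrite Ey poweRyr ?ltNge ?leey//.
  by rewrite invr_eq0 gt_eqF//; exact: lt_le_trans p1.
have [n [f [ts [[fb _] _ etaE]]]] := eta0 k.
have [M M0 fM] : exists2 M : R, 0 < M & forall w, `|eta k w v| <= M.
  case: fb => M [_ /(_ (Num.max M 0 + 1))] h; exists (Num.max M 0 + 1).
    by rewrite ltr_wpDl// le_max lexx orbT.
  by move=> w; rewrite etaE; apply: h => //; rewrite ltr_pwDr// le_max lexx.
have mXv := mX _ vT.
(* The excess of |X_v| over M + 1 depends on X_v alone, so it is measurable, and it lies below the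
   p-th power. *)
pose m (w : BOmega T) : R := Num.max (`|X w v| - (M + 1)) 0.
have mm : measurable_fun setT m.
  apply: measurable_maxr; last exact: measurable_cst.
  by apply: measurable_funB; [exact: measurableT_comp|exact: measurable_cst].
have m_int : mu.-integrable setT (EFin \o m).
  apply/integrableP; split; first exact/measurable_EFinP.
  apply: le_lt_trans Efin; apply: le_trans (integral_le_Ehat _ Pmu).
  apply: ae_le_integral; apply: nearW => w /=.
  apply: (@le_trans _ _ (`|X w v - eta k w v| `^ p)%:E); last first.
    by apply: ereal_sup_ubound; exists v.
  have m0 : 0 <= m w by rewrite /m le_max lexx orbT.
  rewrite lee_fin ger0_norm// /m ge_max powR_ge0 andbT.
  have : `|X w v - eta k w v| <= 1 + `|X w v - eta k w v| `^ p.
    have [x1|x1] := leP (`|X w v - eta k w v|) 1.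
      by rewrite (le_trans x1)// lerDl powR_ge0.
    rewrite -[leLHS]powRr1// (@le_trans _ _ (`|X w v - eta k w v| `^ p))//.
      by apply: ler_powR => //; exact: ltW.
    by rewrite lerDr.
  have := ler_distD (eta k w v) (X w v) 0; rewrite !subr0.
  by have := fM w; lra.
have c_int : mu.-integrable setT (EFin \o cst (M + 1)).
  exact: finite_measure_integrable_cst.
apply: le_integrable (integrableD measurableT m_int c_int) => //.
  exact/measurable_EFinP.
move=> w _ /=; rewrite lee_fin [leRHS]ger0_norm.
  by rewrite -lerBlDr /m le_max lexx.
by rewrite addr_ge0// ?addr_ge0// ?(ltW M0)// /m le_max lexx orbT.
Qed.

Lemma Hl_continuous l (w : Omega T) t : Hl P l -> t \in `[0, T] ->
  continuous (l w t).
Proof.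
move=> [lc _ _ _] tT x; apply/cvgrPdist_lt => e e0.
have [d d0 h] := lc e e0.
apply/nbhs_ballP; exists d => //= y xy; apply: h => //.
by rewrite subrr normr0.
Qed.

Lemma Hl_measurable l X (t : R) : Hl P l -> t \in `[0, T] ->
  measurable_fun [set: BOmega T] (X^~ t : BOmega T -> R) ->
  measurable_fun [set: BOmega T] ((fun w => l w t (X w t)) : BOmega T -> R).
Proof.
move=> lH tT mX.
apply: (@measurable_caratheodory _ (BOmega T) _ (fun w => l w t)).
- by move=> x; case: lH => _ _ [/(_ t x tT)[]].
- by move=> w; exact: Hl_continuous lH tT.
- exact: mX.
Qed.

(** In the assumption the exceptional set depends on x and y. A single null set serves all rational
    pairs, and continuity of [l] in x extends the bounds to the reals, one variable at a time. *)
Lemma Hl'_lipschitz_ae l F (cl Cl : R) mu t : Hl P l -> Hl' P l F cl Cl ->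
  P mu -> t \in `[0, T] ->
  \forall w \ae mu, forall x y, cl * `|x - y| <= `|l w t x - l w t y| /\
    `|l w t x - l w t y| <= Cl * `|x - y|.
Proof.
move=> lH [_ _ _ lip] Pmu tT.
have : \forall w \ae mu, forall q : rat * rat, let x := ratr q.1 in
    let y := ratr q.2 in cl * `|x - y| <= `|l w t x - l w t y| /\
    `|l w t x - l w t y| <= Cl * `|x - y|.
  by apply: ae_forall_countable => q; apply: quasi_surely_ae => //; exact: lip.
apply: filterS => w lw.
have cdist (c z : R) : continuous (fun x : R => c * `|x - z|).
  move=> x; apply: cvgM; first exact: cvg_cst.
  by apply: cvg_norm; apply: cvgB; [exact: cvg_id|exact: cvg_cst].
have cl_dist (z : R) : continuous (fun x => `|l w t x - l w t z|).
  move=> x; apply: cvg_norm; apply: cvgB; last exact: cvg_cst.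
  exact: Hl_continuous lH tT x.
have step (q : rat) x : cl * `|x - ratr q| <= `|l w t x - l w t (ratr q)| /\
    `|l w t x - l w t (ratr q)| <= Cl * `|x - ratr q|.
  split; move: x; apply: dense_rat_le => //.
    by move=> q'; have [] := lw (q', q).
  by move=> q'; have [] := lw (q', q).
move=> x y; rewrite distrC [`|l _ _ _ - _|]distrC; split; move: y.
  apply: dense_rat_le => // q; rewrite distrC [`|l _ _ _ - _|]distrC.
  by have [] := step q x.
apply: dense_rat_le => // q; rewrite distrC [`|_ - x|]distrC.
by have [] := step q x.
Qed.

Lemma Hl'_time_ae l F (cl Cl : R) mu s t : Hl P l -> Hl' P l F cl Cl ->
  P mu -> s \in `[0, T] -> t \in `[0, T] ->
  \forall w \ae mu, forall x, `|l w t x - l w s x| <= F `|t - s|.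
Proof.
move=> lH [_ _ lF _] Pmu sT tT.
have : \forall w \ae mu, forall q : rat,
    `|l w t (ratr q) - l w s (ratr q)| <= F `|t - s|.
  by apply: ae_forall_countable => q; apply: quasi_surely_ae => //; exact: lF.
apply: filterS => w lw; apply: dense_rat_le => //; last exact: cst_continuous.
by move=> x; apply: cvg_norm; apply: cvgB; exact: Hl_continuous x.
Qed.

(** Linear growth at x = 0 and the Lipschitz bound give |l(t,X_t)| <= kappa + C_l |X_t| almost
    surely. *)
Lemma Hl_integrable l F (cl Cl : R) X mu t : Hl P l -> Hl' P l F cl Cl ->
  P mu -> t \in `[0, T] -> mu.-integrable setT (fun w => (X w t)%:E) ->
  mu.-integrable setT (fun w => (l w t (X w t))%:E).
Proof.
move=> lH lH' Pmu tT Xint.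
have mX : measurable_fun [set: BOmega T] (X^~ t : BOmega T -> R).
  by have /measurable_int /measurable_EFinP := Xint.
have [kappa kappa0 lk] : exists2 kappa : R, 0 < kappa &
    forall t x, t \in `[0, T] ->
        quasi_surely P (fun w => `|l w t x| <= kappa * (1 + `|x|)).
  by case: lH.
have [_ /andP[cl0 clCl] _ _] := lH'.
apply/integrableP; split.
  by apply/measurable_EFinP; exact: Hl_measurable lH tT mX.
apply: (@le_lt_trans _ _ (\int[mu]_w (kappa%:E + Cl%:E * `|(X w t)%:E|))%E).
  apply: ae_le_integral.
  have := quasi_surely_ae Pmu (lk t 0 tT).
  apply: filterS2 (Hl'_lipschitz_ae lH lH' Pmu tT) => w lw l0.
  rewrite /= lee_fin; have [_] := lw (X w t) 0.
  move: l0; rewrite subr0 normr0 addr0 mulr1.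
  have := ler_distD (l w t 0) (l w t (X w t)) 0; rewrite !subr0; lra.
have aXint := integrable_abse Xint.
rewrite integralD//=; [|exact: finite_measure_integrable_cst|].
  rewrite integral_cst// integralZl//.
  rewrite [X in (_ * X + _)%E](_ : _ = 1%E) ?mule1;
    last exact: probability_setT.
  apply: lte_add_pinfty; first exact: ltry.
  apply: lte_mul_pinfty => //; first by rewrite lee_fin ltW// (lt_trans cl0).
  by case/integrableP: Xint.
exact: integrableZl.
Qed.

(** One null set for all times: the equation holds at the clamped rational times, and both sides
    have continuous paths. *)
Lemma SP_solution_ae (p : R) l S X (A : incr_fun T) mu : 0 <= T -> P mu ->
  SG P p S -> SP_solution P p l S X A ->
  \forall w \ae mu, forall t, t \in `[0, T] -> X w t = S w t + A t.
Proof.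
move=> T0 Pmu [_ cS _] [[_ cX _] XSA _ _].
have := quasi_surely_ae Pmu cS; have := quasi_surely_ae Pmu cX.
have : \forall w \ae mu, forall q : rat, let t := clamp 0 T (ratr q) in
    X w t = S w t + A t.
  by apply: ae_forall_countable => q; apply: quasi_surely_ae => //;
    apply: XSA; exact: clamp_itv.
apply: filterS3 => w XSw cXw cSw t tT.
have cSA : {within `[0, T], continuous (fun t => S w t + A t)}.
  by move=> x; apply: cvgD; [exact: cSw|exact: incr_cont].
by apply/eqP; rewrite eq_le; apply/andP; split; move: t tT;
  apply: clamp_rat_le => // q; rewrite XSw.
Qed.

End G_framework.

(** * Increments of A and of X *)

Section drift.
Context {R : realType} (T : R) (P : set (probability (BOmega T) R)).
Context (l : Omega T -> R -> R -> R) (F : R -> R) (cl Cl p : R).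
Context (S X : Omega T -> R -> R) (A : incr_fun T).
Hypothesis T_gt0 : 0 < T.
Hypotheses (l_Hl : Hl P l) (l_Hl' : Hl' P l F cl Cl) (S_HS : HS P p l S).
Hypothesis XA_sol : SP_solution P p l S X A.
Implicit Type mu : probability (BOmega T) R.

(** Pass from l(s, S_s + A_s) to l(v, S_v + A_v) through l(v, S_s + A_s) and l(v, S_s + A_v): the
    change of time costs at most F, the increase of A gains at least c_l (A_v - A_s), and the change
    of S costs at most C_l |S_v - S_s|. *)
Lemma drift_le_integral mu (s v : R) : P mu -> s \in `[0, T] -> v \in `[0, T] ->
  s <= v ->
  ((cl * (A v - A s))%:E + \int[mu]_w (l w s (X w s))%:E <=
   \int[mu]_w (l w v (X w v))%:E +
   (Cl%:E * \int[mu]_w (`|S w v - S w s|)%:E + (F `|v - s|)%:E))%E.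
Proof.
move=> Pmu sT vT sv.
have [p1 SGS _] := S_HS; have [SGX _ _ _] := XA_sol.
have [_ /andP[cl0 clCl] _ _] := l_Hl'.
have lXint t : t \in `[0, T] ->
    mu.-integrable setT (fun w => (l w t (X w t))%:E).
  move=> tT; apply: (Hl_integrable l_Hl l_Hl') => //.
  exact: SG_integrable SGX Pmu tT.
have dS : mu.-integrable setT (fun w => (`|S w v - S w s|)%:E).
  exact: (integrable_abse (integrableB measurableT
    (SG_integrable p1 SGS Pmu vT) (SG_integrable p1 SGS Pmu sT))).
have cst_int (c : R) : mu.-integrable setT (fun _ : BOmega T => c%:E).
  exact: finite_measure_integrable_cst.
have int_cst (c : R) : (\int[mu]_w c%:E = c%:E)%E.
  rewrite integral_cst// -[RHS]mule1; congr (_ * _)%E; exact: probability_setT.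
(* Constants become integrals under the probability [mu], so that each side is a single integral. *)
rewrite -(integralZl measurableT dS) -(int_cst (cl * _)) -(int_cst (F _)).
have ClS := integrableZl measurableT Cl dS.
rewrite -(integralD measurableT (cst_int _) (lXint _ sT)).
rewrite -(integralD measurableT ClS (cst_int _)).
rewrite -(integralD measurableT (lXint _ vT)
  (integrableD measurableT ClS (cst_int _))).
apply: ae_le_integral.
have [_ l_incr _ _] := l_Hl.
have := quasi_surely_ae Pmu (l_incr _ vT).
have := Hl'_lipschitz_ae l_Hl l_Hl' Pmu vT.
have := Hl'_time_ae l_Hl l_Hl' Pmu sT vT.
have := SP_solution_ae (ltW T_gt0) Pmu SGS XA_sol.
move=> h1 h2 h3.
apply: filterS2 (filterI h1 (filterI h2 h3)) => w [XSA [lF lip]] lw.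
rewrite /= lee_fin !XSA//.
have Asv : A s <= A v by exact: incr_nd.
have [_ l1] := lip (S w v + A v) (S w s + A v).
(* Monotonicity of [l] in x removes the absolute value from the lower Lipschitz bound. *)
have l2 : cl * (A v - A s) <= l w v (S w s + A v) - l w v (S w s + A s).
  have [] := lip (S w s + A v) (S w s + A s).
  rewrite (_ : S w s + A v - _ = A v - A s); last by ring.
  rewrite ger0_norm ?subr_ge0// ger0_norm ?subr_ge0//.
  by apply: (ltW_homo lw); rewrite lerD2l.
have := lF (S w s + A s).
move: l1; rewrite (_ : S w v + A v - _ = S w v - S w s); last by ring.
rewrite !ler_norml => /andP[l1 _] /andP[l3 _].
lra.
Qed.

Lemma drift_le (s t : R) : 0 <= s -> s <= t -> t <= T ->
  ((A t - A s)%:E <= ((Cl + 1) / cl)%:E *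
    (ereal_sup [set Ehat P (fun w => (`|S w r - S w s|)%:E) | r in `[s, t]]
     + (F `|t - s|)%:E))%E.
Proof.
move=> s0 st tT.
have sT : s \in `[0, T] by rewrite in_itv/= s0 (le_trans st).
have tT' : t \in `[0, T] by rewrite in_itv/= (le_trans s0 st) tT.
have [[_ F_nd F_ge0 _] /andP[cl0 clCl] _ _] := l_Hl'.
have [_ _ lX0 IlX0] := XA_sol.
have C0 : 0 < (Cl + 1) / cl by rewrite divr_gt0// addr_gt0// (lt_trans cl0).
set M := ereal_sup _.
have Sle r : r \in `[s, t] -> (Ehat P (fun w => (`|S w r - S w s|)%:E) <= M)%E.
  by move=> rst; apply: ereal_sup_ubound; exists r.
(* Over an empty P the supremum would be [-oo], against E[l(s,X_s)] >= 0. *)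
have [mu0 Pmu0] : exists mu, P mu.
  apply: contrapT => P0; have := lX0 _ sT; rewrite /Ehat.
  rewrite (_ : [set _ | _ in _] = set0) ?ereal_sup0//.
  by rewrite -subset0 => y [mu Pmu _]; apply: P0; exists mu.
have M0 : (0 <= M)%E.
  apply: le_trans (Sle s _); last by rewrite in_itv/= lexx st.
  by apply: le_trans (integral_le_Ehat _ Pmu0); exact: integral_ge0.
case EM : M M0 Sle => [m| |] // m0 Sle; last first.
  by rewrite addye// gt0_muley ?leey// lte_fin.
rewrite -EFinD -EFinM lee_fin; rewrite lee_fin in m0.
set f := F _; have f0 : 0 <= f by exact: F_ge0.
have Ast : A s <= A t by exact: incr_nd.
rewrite leNgt; apply/negP => lt_drift.
(* The coefficients C_l of [m] and 1 of [f] are both at most C_l + 1. *)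
have ltA : cl^-1 * (Cl * m + f) < A t - A s.
  apply: le_lt_trans lt_drift; rewrite mulrAC [leRHS]mulrC ler_pM2l ?invr_gt0//.
  have := mulr_ge0 (ltW (lt_trans cl0 clCl)) f0; lra.
have {ltA} : Cl * m + f < cl * (A t - A s).
  by rewrite -ltr_pdivrMl.
have : 0 < A t - A s.
  by apply: le_lt_trans lt_drift; rewrite mulr_ge0 ?addr_ge0// ltW.
set a := A t - A s => a0 ltA.
(* The losses below are c_l e from A_v >= A_t - e, e from E[l(v,X_v)] < e, and e from the choice of
   [mu]; c_l + 3 leaves a strict margin. The bound e <= a keeps A_t - e above A_s for the
   intermediate value theorem. *)
pose e := Num.min a ((cl * a - (Cl * m + f)) / (cl + 3)).
have cl3 : 0 < cl + 3 by lra.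
have e0 : 0 < e by rewrite lt_min a0 divr_gt0// subr_gt0.
have ea : e <= a by rewrite ge_min lexx.
have ecl : (cl + 3) * e <= cl * a - (Cl * m + f).
  by rewrite mulrC -ler_pdivlMr// ge_min lexx orbT.
have [u] : exists2 u, u \in `[s, t] & A u = A t - e.
  apply: IVT => //.
    apply: continuous_subspaceW (@incr_cont _ _ A) => x /=; rewrite !in_itv/=.
    by move=> /andP[sx xt]; rewrite (le_trans s0 sx) (le_trans xt tT).
  rewrite (min_idPl Ast) (max_idPr Ast); move: ea; rewrite /a; lra.
rewrite in_itv/= => /andP[su ut] Au.
have ltut : u < t.
  by rewrite lt_neqAle ut andbT; apply/eqP => ute; move: Au; rewrite ute; lra.
have Aut : A u < A t by rewrite Au; lra.
have [v] := stieltjes_integral_eq0_lt lX0 IlX0 (le_trans s0 su) ltut tT Aut e0.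
rewrite in_itv/= => /andP[uv vt] lv.
have uT : u \in `[0, T] by rewrite in_itv/= (le_trans s0 su) (le_trans ut).
have sv : s <= v by rewrite (le_trans su)// ltW.
have vT : v \in `[0, T] by rewrite in_itv/= (le_trans s0 sv) (le_trans vt).
(* A measure that attains E[l(s,X_s)] >= 0 up to [e]. *)
have [_ [mu Pmu <-] lmu] : exists2 y,
    [set (\int[mu]_w (l w s (X w s))%:E)%E | mu in P] y & ((- e)%:E < y)%E.
  by apply/ereal_sup_gt/(lt_le_trans _ (lX0 _ sT)); rewrite lte_fin oppr_lt0.
have := drift_le_integral Pmu sT vT sv.
have Iv : (\int[mu]_w (l w v (X w v))%:E < e%:E)%E.
  exact: le_lt_trans (integral_le_Ehat _ Pmu) lv.
have IS : (\int[mu]_w (`|S w v - S w s|)%:E <= m%:E)%E.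
  by apply: le_trans (integral_le_Ehat _ Pmu) (Sle v _); rewrite in_itv/= sv vt.
have Fv : F `|v - s| <= f.
  apply: F_nd; rewrite ?in_itv/= ?andbT//.
  by rewrite !ger0_norm ?subr_ge0// lerD2r.
have Av : A t - e <= A v by rewrite -Au; apply: incr_nd => //; exact: ltW.
have clA : cl * (A t - e - A s) <= cl * (A v - A s).
  by rewrite ler_pM2l// lerD2r.
apply/negP; rewrite -ltNge.
apply: (@le_lt_trans _ _ (e%:E + (Cl%:E * m%:E + f%:E))%E).
  apply: leeD; first exact: ltW.
  apply: leeD; last by rewrite lee_fin.
  by apply: lee_wpmul2l => //; rewrite lee_fin ltW// (lt_trans cl0).
apply: (@lt_le_trans _ _ ((cl * (A v - A s))%:E + (- e)%:E)%E); last first.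
  by apply: leeD => //; exact: ltW.
rewrite -EFinM -!EFinD lte_fin; move: ecl clA; rewrite /a; nra.
Qed.

Lemma Ehat_sup_increment_le (s t : R) : 0 <= s -> s <= t -> t <= T ->
  (Ehat P (fun w => ereal_sup [set (`|X w r - X w s|)%:E | r in `[s, t]]) <=
   Ehat P (fun w => ereal_sup [set (`|S w r - S w s|)%:E | r in `[s, t]])
   + (A t - A s)%:E)%E.
Proof.
move=> s0 st tT.
have sT : s \in `[0, T] by rewrite in_itv/= s0 (le_trans st).
have tT' : t \in `[0, T] by rewrite in_itv/= (le_trans s0 st) tT.
have stT r : r \in `[s, t] -> r \in `[0, T].
  rewrite !in_itv/= => /andP[sr rt].
  by rewrite (le_trans s0 sr) (le_trans rt tT).
have Ast : A s <= A t by exact: incr_nd.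
have [p1 SGS _] := S_HS; have [mS cS _] := SGS.
apply: ge_ereal_sup => _ [mu Pmu <-].
(* The supremum over clamped rational times is measurable, so the constant A_t - A_s can be split
   off its integral; it agrees with the full supremum on continuous paths. *)
pose g (w : BOmega T) :=
  ereal_sup (range (fun q : rat => (`|S w (clamp s t (ratr q)) - S w s|)%:E)).
have mg : measurable_fun setT g.
  apply: measurable_fun_ereal_sup_countable => q.
  apply/measurable_EFinP; apply: measurableT_comp => //.
  by apply: measurable_funB; apply: mS => //; apply: stT; exact: clamp_itv.
have g0 w : (0 <= g w)%E.
  apply: (@le_trans _ _ (`|S w (clamp s t (ratr 0)) - S w s|)%:E).
    by rewrite lee_fin.
  by apply: ereal_sup_ubound; exists 0.
apply: (@le_trans _ _ (\int[mu]_w (g w + (A t - A s)%:E))%E).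
  apply: ae_le_integral.
  have := SP_solution_ae (ltW T_gt0) Pmu SGS XA_sol.
  apply: filterS2 (quasi_surely_ae Pmu cS) => w cSw XSA.
  apply: ge_ereal_sup => _ [r rst <-].
  have Sg : ((`|S w r - S w s|)%:E <= g w)%E.
    have [->|gy] := eqVneq (g w) +oo%E; first exact: leey.
    have gE : g w = (fine (g w))%:E by rewrite fineK// ge0_fin_numE// ltey.
    rewrite gE lee_fin.
    apply: (@clamp_rat_le _ s t (fun r => `|S w r - S w s|)
      (fun=> fine (g w))) => //.
    - have cst' : {within `[s, t], continuous (S w)}.
        by apply: continuous_subspaceW cSw => x; exact: stT.
      by move=> x; apply: cvg_norm; apply: cvgB; [exact: cst'|exact: cvg_cst].
    - by apply: continuous_subspaceT => x; exact: cvg_cst.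
    by move=> q; rewrite -lee_fin -gE; apply: ereal_sup_ubound; exists q.
  apply: le_trans (leeD2r _ Sg); rewrite -EFinD lee_fin.
  rewrite (XSA _ (stT _ rst)) (XSA _ sT).
  rewrite (_ : _ - _ = (S w r - S w s) + (A r - A s)); last by ring.
  apply: le_trans (ler_normD _ _) _; rewrite lerD2l.
  move: rst; rewrite /= in_itv/= => /andP[sr rt].
  have rT : r \in `[0, T] by apply: stT; rewrite in_itv/= sr rt.
  by rewrite ger0_norm ?subr_ge0 ?lerD2r; exact: incr_nd.
rewrite ge0_integralD//; last by move=> w _; rewrite lee_fin subr_ge0.
apply: leeD; last first.
  rewrite integral_cst// [X in (_ * X)%E](_ : _ = 1%E) ?mule1//.
  exact: probability_setT.
(* Pointwise, [g] is a supremum over fewer times of [s, t]. *)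
apply: le_trans (integral_le_Ehat _ Pmu).
apply: ae_le_integral; apply: nearW => w.
apply: ge_ereal_sup => _ [q _ <-]; apply: ereal_sup_ubound.
by exists (clamp s t (ratr q)) => //; exact: clamp_itv.
Qed.

End drift.

(** * Combination of the two estimates *)

Theorem corollary3p11 (R : realType) (T slo shi : R)
    (P : set (probability (BOmega T) R))
    (l : Omega T -> R -> R -> R) (F : R -> R) (cl Cl p : R)
    (S X : Omega T -> R -> R) (A : incr_fun T)
    (T_gt0 : 0 < T) (sigma_pos : 0 < slo ^+ 2) (sigma_lt : slo ^+ 2 < shi ^+ 2)
    (P_rep : represents_G_expectation P slo shi)
    (l_Hl : Hl P l) (l_Hl' : Hl' P l F cl Cl) (S_HS : HS P p l S)
    (XA_sol : SP_solution P p l S X A) :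
  exists2 C : R, 0 < C & forall s t : R, 0 <= s -> s <= t -> t <= T ->
    ((`|A t - A s|)%:E <=
       C%:E * (ereal_sup [set Ehat P (fun w => (`|S w r - S w s|)%:E)
                         | r in `[s, t]%classic]
               + (F `|t - s|)%:E))%E /\
    (Ehat P (fun w => ereal_sup [set (`|X w r - X w s|)%:E
                                | r in `[s, t]%classic]) <=
       C%:E * (Ehat P (fun w => ereal_sup [set (`|S w r - S w s|)%:E
                                          | r in `[s, t]%classic])
               + (F `|t - s|)%:E))%E.
Proof.
have [[_ _ F_ge0 _] /andP[cl0 clCl] _ _] := l_Hl'.
pose C0 := (Cl + 1) / cl.
have C0_gt0 : 0 < C0 by rewrite divr_gt0// addr_gt0// (lt_trans cl0).
(* [C0] accounts for the increment of A, and 1 for the supremum of the increments of S. *)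
exists (1 + C0); first exact: addr_gt0.
move=> s t s0 st tT.
have drift := drift_le T_gt0 l_Hl l_Hl' S_HS XA_sol s0 st tT.
have sup_incr := Ehat_sup_increment_le T_gt0 S_HS XA_sol s0 st tT.
move: drift sup_incr; rewrite -/C0.
set f := F _; have f0 : 0 <= f by exact: F_ge0.
set M := ereal_sup _; set N := Ehat P _; set K := Ehat P _.
have Ast : A s <= A t.
  apply: incr_nd => //; rewrite in_itv/=.
    by rewrite s0 (le_trans st).
  by rewrite tT (le_trans s0).
(* The supremum of expectations is at most the expectation of the supremum. *)
have MN : (M <= K)%E.
  apply: ge_ereal_sup => _ [r rst <-]; apply: le_Ehat => mu _.
  by apply: nearW => w; apply: ereal_sup_ubound; exists r.
move=> drift sup_incr.
(* The sign is read off the drift bound, whose left side is nonnegative. *)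
have Mf0 : (0 <= M + f%:E)%E.
  rewrite -(pmule_rge0 _ (_ : 0 < C0%:E)%E) ?lte_fin//.
  by apply: le_trans drift; rewrite lee_fin subr_ge0.
rewrite ger0_norm ?subr_ge0//; split.
  by apply: (le_trans drift); apply: lee_wpmul2r => //; rewrite lee_fin lerDr.
apply: (le_trans sup_incr).
have Kf0 : (0 <= K + f%:E)%E by apply: (le_trans Mf0); exact: leeD2r.
rewrite (EFinD 1 C0) ge0_muleDl ?lee_fin ?(ltW C0_gt0)// mul1e.
apply: leeD; first by rewrite leeDl// lee_fin.
apply: (le_trans drift); apply: lee_wpmul2l; first by rewrite lee_fin ltW.
exact: leeD2r.
Qed.
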